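(* Let $\mathcal{H}$ be a real Hilbert space, let $Z$ be a nonempty closed convex subset of $\mathcal{H}$, let $(\lambda_n)_{n\in\mathbb{N}}$ be a sequence in $]0,2[$, and let $x_0\in\mathcal{H}$. Let $(x_n)_{n\in\mathbb{N}}$ be generated by the following iteration: for every $n\in\mathbb{N}$, $H_n$ is a closed half-space of $\mathcal{H}$ such that $Z\subset H_n$, and $$p_n=\mathrm{proj}_{H_n}x_n,\qquad x_{n+1}=x_n+\lambda_n(p_n-x_n).$$ Then the following hold: (i) $(\forall z\in Z)(\forall n\in\mathbb{N})$ $\|x_{n+1}-z\|\leq\|x_n-z\|$. (ii) $\sum_{n\in\mathbb{N}}\lambda_n(2-\lambda_n)\|p_n-x_n\|^2<+\infty$. (iii) Suppose that $\sup_{n\in\mathbb{N}}\lambda_n<2$. Then $\sum_{n\in\mathbb{N}}\|x_{n+1}-x_n\|^2<+\infty$. (iv) Suppose that every weak sequential cluster point of $(x_n)_{n\in\mathbb{N}}$ belongs to $Z$. Then $(x_n)_{n\in\mathbb{N}}$ converges weakly to a point in $Z$.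
   Context: $\mathrm{proj}_D$ denotes the projection operator onto a nonempty closed convex set $D\subset\mathcal{H}$. A weak sequential cluster point of a sequence is a weak limit of one of its subsequences. *)

(* Defs.v *)
From mathcomp Require Import all_boot all_order all_algebra.
From mathcomp Require Import all_classical all_reals all_analysis.
Set Implicit Arguments.
Unset Strict Implicit.
Unset Printing Implicit Defensive.

Import Order.TTheory GRing.Theory Num.Theory.
Import numFieldNormedType.Exports.

Local Open Scope classical_set_scope.
Local Open Scope ring_scope.

(* A real Hilbert space is rendered as a complete normed module [H] over a
   [realType] together with a definite symmetric bilinear form
   [dot : {dot H for idfun}] whose quadratic form is the squared norm, i.e.
   the norm (and hence the topology) of [H] is the one given by [dot]. *)
Definition induces_norm (R : realType) (H : normedModType R)
    (dot : {dot H for idfun}) : Prop :=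
  forall x : H, dot x x = `|x| ^+ 2.

Definition closed_half_space (R : realType) (H : normedModType R)
    (dot : {dot H for idfun}) (D : set H) : Prop :=
  exists (u : H) (eta : R), u != 0 /\ D = [set x | dot x u <= eta].

(* The point of [D] nearest to [x]; for [D] nonempty, closed and convex in a
   Hilbert space it exists and is unique, so the default value [0] of the
   choice operator plays no role. *)
Definition convex_proj (R : realType) (H : normedModType R)
    (D : set H) (x : H) : H :=
  xget 0 [set p | D p /\ forall y, D y -> `|x - p| <= `|x - y|].

Definition weakly_cvg (R : realType) (H : normedModType R)
    (dot : {dot H for idfun}) (x : nat -> H) (y : H) : Prop :=
  forall u : H, dot (x n) u @[n --> \oo] --> dot y u.

Definition weak_seq_cluster_point (R : realType) (H : normedModType R)
    (dot : {dot H for idfun}) (x : nat -> H) (y : H) : Prop :=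
  exists2 k : nat -> nat, increasing_seq k & weakly_cvg dot (x \o k) y.

(* Main.v *)
(* The half-space H_n lies on the side of p_n away from x_n, so that
   |x_{n+1} - z|^2 <= |x_n - z|^2 - lambda_n (2 - lambda_n) |p_n - x_n|^2 for
   every z in Z; this gives (i), and (ii) by telescoping. For (iii),
   lambda_n <= 2 / (2 - sup lambda) * (2 - lambda_n). For (iv), the bounded
   sequence has a weak limit along every ultrafilter, each such limit is a weak
   sequential cluster point, hence in Z, and Opial's argument shows that all
   these limits coincide. *)
Require Import Defs.
From mathcomp Require Import all_boot all_order all_algebra.
From mathcomp Require Import all_classical all_reals all_analysis.
From mathcomp Require Import ring lra.
Set Implicit Arguments.
Unset Strict Implicit.
Unset Printing Implicit Defensive.

Import Order.TTheory GRing.Theory Num.Theory.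
Import numFieldNormedType.Exports.
Local Open Scope classical_set_scope.
Local Open Scope ring_scope.

(** * Scalar preliminaries *)

(** Compactness of [[-M, M]] yields a cluster point, and an ultrafilter converges to each of its
    cluster points. *)
Lemma bounded_cvg_ultra (R : realType) (T : Type) (U : set_system T)
    (UU : UltraFilter U) (f : T -> R) (M : R) :
  (forall t, `|f t| <= M) -> exists l : R, f t @[t --> U] --> l.
Proof.
move=> fM.
have PF : ProperFilter (f @ U) by apply: fmap_proper_filter.
have [|l [_ fl]] := @segment_compact R (- M) M (f @ U) PF.
  by apply: (@filterE _ U) => t /=; rewrite in_itv/= -ler_norml; exact: fM.
exists l => A Al; have [//|UnA] := in_ultra_setVsetC (f @^-1` A) UU.
by have [s [nAs /nAs]] := fl (~` A) A UnA Al.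
Qed.

Lemma quadratic_ge0_linear_coef_ge0 (R : realFieldType) (a b : R) : 0 <= b ->
  (forall t, 0 <= t <= 1 -> 0 <= 2 * t * a + t ^+ 2 * b) -> 0 <= a.
Proof.
move=> b0 h; rewrite leNgt; apply/negP => a0.
have d0 : 0 < b - a by lra.
(* At [t = - a / (b - a)] one gets [2 * a + t * b = a * (1 + t) < 0]. The denominator [b - a] covers
   [b = 0] and keeps [t <= 1]. *)
have t0 : 0 < - a / (b - a) by rewrite divr_gt0// oppr_gt0.
have t1 : - a / (b - a) <= 1 by rewrite ler_pdivrMr//; lra.
have tE : - a / (b - a) * (b - a) = - a by rewrite divfK// gt_eqF.
have := h (- a / (b - a)); rewrite t1 ltW//= => /(_ isT).
move: (- a / (b - a)) t0 t1 tE => t t0 t1 tE.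
rewrite expr2 (_ : _ + _ = t * (2 * a + t * b)); last by ring.
rewrite pmulr_rge0//; nra.
Qed.

Lemma nneseries_partial_bounded_lty (R : realType) (u : nat -> R) (M : R) :
  (forall n, 0 <= u n) -> (forall n, \sum_(0 <= i < n) u i <= M) ->
  (\sum_(0 <= n <oo) (u n)%:E < +oo)%E.
Proof.
move=> u0 uM; apply: (@le_lt_trans _ _ M%:E); last exact: ltry.
apply: lime_le; first by apply: is_cvg_nneseries => n _ _; rewrite lee_fin.
by apply: nearW => n; rewrite sumEFin lee_fin.
Qed.

(** * Hilbert space geometry: variational inequality and projections *)

Section RealHilbert.
Context (R : realType) (H : completeNormedModType R).
Context (dot : {dot H for idfun}) (dotE : induces_norm dot).
Implicit Types (u v w z : H) (C : set H).

Let dotDl u v w : dot (u + v) w = dot u w + dot v w.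
Proof. exact: linearDl. Qed.
Let dotDr u v w : dot w (u + v) = dot w u + dot w v.
Proof. exact: linearDr. Qed.
Let dotBl u v w : dot (u - v) w = dot u w - dot v w.
Proof. exact: linearBl. Qed.
Let dotBr u v w : dot w (u - v) = dot w u - dot w v.
Proof. exact: linearBr. Qed.
Let dotZl a u v : dot (a *: u) v = a * dot u v.
Proof. exact: linearZl_LR. Qed.
Let dotZr a u v : dot v (a *: u) = a * dot v u.
Proof. exact: linearZr_LR. Qed.
Let dotC u v : dot u v = dot v u.
Proof. by rewrite hermC expr0 mul1r. Qed.
Let sqr_normD u v : `|u + v| ^+ 2 = `|u| ^+ 2 + 2 * dot u v + `|v| ^+ 2.
Proof. by rewrite -!dotE dotDl !dotDr (dotC v u); ring. Qed.

Let sqr_normB u v : `|u - v| ^+ 2 = `|u| ^+ 2 - 2 * dot u v + `|v| ^+ 2.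
Proof. by rewrite -!dotE dotBl !dotBr (dotC v u); ring. Qed.

Lemma cauchy_schwarz_norm u v : `|dot u v| <= `|u| * `|v|.
Proof.
have [->|v0] := eqVneq v 0; first by rewrite linear0r !normr0 mulr0.
have v2 : 0 < `|v| ^+ 2 by rewrite exprn_gt0// normr_gt0.
rewrite -(@ler_pXn2r _ 2)// ?nnegrE ?mulr_ge0//.
rewrite real_normK ?num_real// exprMn.
(* This square expands to [|v|^2 (|u|^2 |v|^2 - (dot u v)^2)]. *)
have := sqr_ge0 `|(`|v| ^+ 2) *: u - dot u v *: v|.
rewrite sqr_normB dotZl dotZr !normrZ !exprMn.
rewrite !normr_id real_normK ?num_real//.
move: (dot u v) (`|u| ^+ 2) (`|v| ^+ 2) v2 => d a b b0 h.
have : 0 <= b * (a * b - d ^+ 2) by lra.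
by rewrite pmulr_rge0// subr_ge0.
Qed.

Lemma scalar_bounded_continuous (L : H -> R) (M : R) :
  scalar L -> (forall z, `|L z| <= M * `|z|) -> continuous L.
Proof.
move=> Llin LM z; apply/cvgrPdist_lt => e e0.
have M1 : 0 < `|M| + 1 by rewrite ltr_wpDl.
have LB w : L (z - w) = L z - L w.
  by rewrite addrC -scaleN1r Llin mulN1r addrC.
near=> w; rewrite -LB; apply: le_lt_trans (LM _) _.
have zw : `|z - w| < e / (`|M| + 1).
  near: w; apply: (@cvgr_dist_lt _ _ _ _ _ id z); last by rewrite divr_gt0.
  exact: cvg_id.
move: zw; rewrite ltr_pdivlMr// => zw; apply: le_lt_trans zw.
rewrite mulrC ler_wpM2l//; have := ler_norm M; lra.
Unshelve. all: by end_near. Qed.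

Lemma dot_continuousl u : continuous (dot ^~ u).
Proof.
apply: (@scalar_bounded_continuous _ `|u|).
  by move=> a v w; rewrite dotDl dotZl.
by move=> z; rewrite mulrC cauchy_schwarz_norm.
Qed.

(* Minimise [|z|^2 - 2 L z] over [C]: by the parallelogram law, sublevel sets
   have small diameter, so they generate a Cauchy filter. *)
Lemma stampacchia C (L : H -> R) (M : R) : C !=set0 -> closed C ->
  (forall z w t, C z -> C w -> 0 <= t <= 1 -> C (z + t *: (w - z))) ->
  scalar L -> (forall z, `|L z| <= M * `|z|) ->
  exists2 z, C z & forall w, C w -> L w - L z <= dot z (w - z).
Proof.
move=> C0 Ccl Cconv Llin LM.
have L0 : L 0 = 0.
  by have := Llin (-1) 0 0; rewrite scaleN1r oppr0 addr0 mulN1r addNr.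
have LD z w : L (z + w) = L z + L w.
  by have := Llin 1 z w; rewrite scale1r mul1r.
have LZ a z : L (a *: z) = a * L z.
  by have := Llin a z 0; rewrite !addr0 L0 addr0.
have LB z w : L (z - w) = L z - L w by rewrite LD -scaleN1r LZ mulN1r.
pose q z := `|z| ^+ 2 - 2 * L z.
have q_inf : has_inf (q @` C).
  split; first by have [z Cz] := C0; exists (q z), z.
  exists (- M ^+ 2) => _ [z _ <-]; rewrite /q.
  have := LM z; rewrite ler_norml => /andP[_ LMz].
  have := sqr_ge0 (`|z| - M); rewrite sqrrB -mulr_natl => h; nra.
pose m := inf (q @` C).
have m_le z : C z -> m <= q z.
  by move=> Cz; apply: ge_inf; [exact: q_inf.2|exists z].
pose F := filter_from [set e : R | 0 < e]
  (fun e => C `&` [set z | q z < m + e]).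
have sub_neq0 e : 0 < e -> exists2 z, C z & q z < m + e.
  by move=> e0; have [_ [z Cz <-] qz] := inf_adherent e0 q_inf; exists z.
have FF : ProperFilter F.
  apply: filter_from_proper; last first.
    by move=> e /sub_neq0[z Cz qz]; exists z.
  apply: filter_from_filter; first by exists 1 => /=.
  move=> e1 e2 /= e10 e20; exists (Num.min e1 e2).
    by rewrite /= lt_min e10.
  move=> z /= [Cz qz]; split; split => //; apply: lt_le_trans qz _;
    by rewrite lerD2l ge_min lexx ?orbT.
have Fcauchy : cauchy F.
  apply: cauchy_exP => e e0.
  (* The midpoint of [z] and [w] lies in [C], so [|z - w|^2 / 4 = (q z + q w) / 2 - q mid] is below
     [e^2 / 4] once [q z] and [q w] are below [m + e^2 / 4]. *)
  have d0 : 0 < e ^+ 2 / 4 by rewrite divr_gt0// exprn_gt0.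
  have [z Cz qz] := sub_neq0 _ d0; exists z, (e ^+ 2 / 4) => //.
  move=> w [Cw /= qw]; rewrite -ball_normE /=.
  rewrite -(@ltr_pXn2r _ 2)// ?nnegrE ?normr_ge0 ?ltW//.
  have half : 0 <= (2^-1 : R) <= 1 by lra.
  have := m_le _ (Cconv _ _ _ Cz Cw half); rewrite /q in qz qw *.
  rewrite sqr_normD LD LZ LB dotZr dotBr dotE normrZ exprMn.
  rewrite real_normK ?num_real// (distrC w z) sqr_normB => mid; lra.
have /cauchy_cvg/(_ Fcauchy) Fcvg := FF.
pose z := lim F; have Fz : F --> z by exact: Fcvg.
have Cz : C z.
  apply: (@closed_cvg _ _ F _ id C Ccl _ _ Fz).
  by exists 1 => //= w [].
have qz : q z <= m.
  apply/ler_addgt0Pr => e e0; apply: (@cvgr_to_le _ F _ _ q).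
    apply: cvgB.
      by apply: cvgM; apply: cvg_norm.
    apply: cvgM; first exact: cvg_cst.
    exact: cvg_comp Fz (@scalar_bounded_continuous L M Llin LM z).
  by exists e => //= w [_ /ltW].
(* First-order condition: [q (z + t (w - z)) - q z] is the quadratic in [t] with
   [a = dot z (w - z) - L (w - z)] and [b = |w - z|^2]. *)
exists z => // w Cw; rewrite -subr_ge0.
apply: (@quadratic_ge0_linear_coef_ge0 _ _ (`|w - z| ^+ 2)).
  exact: sqr_ge0.
move=> t t01; have := le_trans qz (m_le _ (Cconv _ _ _ Cz Cw t01)).
rewrite /q sqr_normD LD LZ LB dotZr normrZ exprMn real_normK ?num_real//.
move=> h; lra.
Qed.

(** The point [z] given by [stampacchia] for [L = dot ^~ x] satisfies the inequality. It is
    therefore a nearest point, and the only one, so the choice operator returns it. *)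
Lemma convex_projP C x : C !=set0 -> closed C ->
  (forall z w t, C z -> C w -> 0 <= t <= 1 -> C (z + t *: (w - z))) ->
  forall w, C w -> dot (x - convex_proj C x) (w - convex_proj C x) <= 0.
Proof.
move=> C0 Ccl Cconv.
have xlin : scalar (dot ^~ x) by move=> a v w; rewrite dotDl dotZl.
have xbnd z : `|dot z x| <= `|x| * `|z| by rewrite mulrC cauchy_schwarz_norm.
have [z Cz zP] := stampacchia C0 Ccl Cconv xlin xbnd.
have zvar w : C w -> dot (x - z) (w - z) <= 0.
  by move=> /zP /=; rewrite dotBl (dotC x) dotBl => h; lra.
have dist w : `|x - w| ^+ 2
    = `|x - z| ^+ 2 - 2 * dot (x - z) (w - z) + `|w - z| ^+ 2.
  by rewrite -sqr_normB opprB addrA subrK.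
have [Cp pmin] : [set p | C p /\ forall y, C y -> `|x - p| <= `|x - y|]
    (convex_proj C x).
  apply: (@xgetPex _ 0); exists z; split => // w /zvar zw.
  rewrite -(@ler_pXn2r _ 2)// ?nnegrE// (dist w).
  have := sqr_ge0 `|w - z|; lra.
suff -> : convex_proj C x = z by [].
apply/eqP; rewrite -subr_eq0 -normr_eq0 -sqrf_eq0 eq_le sqr_ge0 andbT.
have := pmin _ Cz.
rewrite -(@ler_pXn2r _ 2)// ?nnegrE// (dist (convex_proj C x)).
have := zvar _ Cp; lra.
Qed.

(** The two sides differ exactly by [2 l (dot (x - p) (z - p))], which is nonpositive. *)
Lemma relaxed_projection_fejer x p z l : 0 <= l -> dot (x - p) (z - p) <= 0 ->
  `|x + l *: (p - x) - z| ^+ 2 <=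
  `|x - z| ^+ 2 - l * (2 - l) * `|p - x| ^+ 2.
Proof.
move=> l0 h.
have -> : x + l *: (p - x) - z = (x - z) - l *: (x - p).
  by rewrite -(opprB x p) scalerN addrAC.
have -> : x - z = (x - p) - (z - p) by rewrite opprB addrA subrK.
rewrite (distrC p) sqr_normB dotZr dotBl dotE normrZ exprMn.
rewrite real_normK ?num_real//.
rewrite (dotC (z - p)); nra.
Qed.

(** * Weak limits along ultrafilters and subsequences *)

Lemma cvg_dot_lincomb (T : Type) (F : set_system T) (FF : Filter F)
    (x : T -> H) v w (a lv lw : R) :
  dot (x t) v @[t --> F] --> lv -> dot (x t) w @[t --> F] --> lw ->
  dot (x t) (v + a *: w) @[t --> F] --> lv + a * lw.
Proof.
move=> xv xw; rewrite (_ : (fun t => _) =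
    (fun t => dot (x t) v + a * dot (x t) w)); last first.
  by apply/funext => t; rewrite dotDr dotZr.
by apply: cvgD => //; apply: cvgM => //; exact: cvg_cst.
Qed.

Lemma bounded_weak_cvg_ultra (T : Type) (U : set_system T)
    (UU : UltraFilter U) (x : T -> H) (M : R) : (forall t, `|x t| <= M) ->
  exists y, forall u, dot (x t) u @[t --> U] --> dot y u.
Proof.
move=> xM.
have dot_le t u : `|dot (x t) u| <= M * `|u|.
  by apply: le_trans (cauchy_schwarz_norm _ _) _; rewrite ler_wpM2r.
have /choice[L Lcvg] : forall u, exists l : R, dot (x t) u @[t --> U] --> l.
  by move=> u; exact: bounded_cvg_ultra (dot_le^~ u).
have Llin : scalar L.
  move=> a v w; apply: (cvg_unique _ (Lcvg _)) => //.
  rewrite (addrC (a *: v)) (addrC (a * L v)).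
  exact: cvg_dot_lincomb.
have LM u : `|L u| <= M * `|u|.
  apply: (@cvgr_to_le _ U _ _ (fun t => `|dot (x t) u|)).
    exact: cvg_norm.
  exact: nearW.
(* Riesz representation: over the whole space, testing with [z + u] and [z - u] turns the inequality
   into an equality. *)
have [|//|z _ zP] := stampacchia _ closedT _ Llin LM; first by exists 0.
exists z => u; suff -> : dot z u = L u by [].
have LD v w : L (v + w) = L v + L w.
  by have := Llin 1 v w; rewrite scale1r mul1r.
have LN : L (- u) = - L u.
  by have := LD u (- u); have := LD 0 0; rewrite addr0 subrr; lra.
have := zP (z + u) I; have := zP (z + - u) I.
by rewrite !LD LN !(addrC z) !addrK linearNr; lra.
Qed.

Lemma ultra_weak_limit_seq_cluster (U : set_system nat) (UU : ProperFilter U)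
    (x : nat -> H) (M : R) y : \oo `<=` U -> (forall n, `|x n| <= M) ->
  (forall u, dot (x n) u @[n --> U] --> dot y u) ->
  weak_seq_cluster_point dot x y.
Proof.
move=> ooU xM xy.
(* Diagonal extraction: members of [U] are nonempty, so at stage [n] there is an index beyond [N]
   that is [1 / (n + 1)]-close to the limit against [x 0, ..., x n]. *)
have /choice[g gP] : forall nN : nat * nat, exists i, (nN.2 < i)%N /\
    forall m, (m <= nN.1)%N -> `|dot y (x m) - dot (x i) (x m)| < nN.1.+1%:R^-1.
  move=> [n N] /=.
  have UN : U [set i | (N < i)%N] by apply: ooU; exact: nbhs_infty_gt.
  have Un : U [set i | forall m : 'I_n.+1,
      `|dot y (x m) - dot (x i) (x m)| < n.+1%:R^-1].
    apply: filter_forall => m.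
    by apply: (@cvgr_dist_lt _ _ _ U _ _ _ (xy (x m))); rewrite invr_gt0.
  have [i [Ni ni]] := filter_ex (filterI UN Un); exists i; split=> // m mn.
  by have := ni (Ordinal (mn : (m < n.+1)%N)).
pose fix k n := if n is n'.+1 then g (n'.+1, k n') else g (0%N, 0%N).
have kP n m : (m <= n)%N -> `|dot y (x m) - dot (x (k n)) (x m)| < n.+1%:R^-1.
  by case: n => [|n]; [exact: (gP (0%N, 0%N)).2|exact: (gP (n.+1, k n)).2].
exists k; first by apply/increasing_seqP => n; exact: (gP (n.+1, k n)).1.
(* The extraction handles only the vectors [x m]. The set [V] of good test
   vectors is a closed subspace containing them, and for [z] the projection of
   [u] onto [V] the vector [u - z] is orthogonal to every [x m], hence to their
   weak limit [y], so that [u - z] is in [V] too. *)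
pose V := [set u | dot (x (k n)) u @[n --> \oo] --> dot y u].
have VD u v a : V u -> V v -> V (u + a *: v).
  by move=> Vu Vv; rewrite /V /= dotDr dotZr; exact: cvg_dot_lincomb.
have Vx m : V (x m).
  apply/cvgrPdist_lt => e e0; near=> n.
  apply: (@lt_trans _ _ n.+1%:R^-1); first apply: kP.
    by near: n; exact: nbhs_infty_ge.
  by near: n; exact: near_infty_natSinv_lt (PosNum e0).
have V0 : V 0.
  by apply: cvg_near_cst; apply: nearW => n; rewrite !linear0r.
have Vcl : closed V.
  move=> u clu; apply/cvgrPdist_lt => e e0.
  (* [c] bounds [|y - x (k n)|] uniformly in [n], so replacing [u] by a nearby [v] in [V] costs less
     than [e / 2]. *)
  pose c := `|y| + `|M| + 1.
  have c0 : 0 < c by rewrite /c ltr_wpDl.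
  have d0 : 0 < e / 2 / c by rewrite !divr_gt0.
  have [v [Vv]] := clu _ (nbhsx_ballx u _ d0).
  rewrite -ball_normE /= ltr_pdivlMr// => uv.
  have e20 : 0 < e / 2 by rewrite divr_gt0.
  near=> n.
  have vn : `|dot y v - dot (x (k n)) v| < e / 2.
    by near: n; exact: (@cvgr_dist_lt _ _ _ \oo _ _ _ Vv).
  rewrite (_ : _ - _ = (dot y v - dot (x (k n)) v) + dot (y - x (k n)) (u - v)).
    apply: le_lt_trans (ler_normD _ _) _.
    rewrite (splitr e) ltrD//; apply: le_lt_trans uv.
    apply: le_trans (cauchy_schwarz_norm _ _) _; rewrite mulrC ler_wpM2l//.
    apply: le_trans (ler_normB _ _) _; rewrite /c.
    have := xM (k n); have := ler_norm M; lra.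
  by rewrite dotBl !dotBr; ring.
have Vconv z w t : V z -> V w -> 0 <= t <= 1 -> V (z + t *: (w - z)).
  by move=> Vz Vw _; apply: (VD) => //; rewrite -scaleN1r; exact: VD.
move=> u.
have ulin : scalar (dot ^~ u) by move=> a v w; rewrite dotDl dotZl.
have ubnd z : `|dot z u| <= `|u| * `|z| by rewrite mulrC cauchy_schwarz_norm.
have [|z Vz zP] := stampacchia _ Vcl Vconv ulin ubnd; first by exists 0.
(* [V] contains both [z + x m] and [z - x m], which gives the variational inequality with both
   signs. *)
have xort m : dot (x m) (u - z) = 0.
  have /= := zP _ (VD _ _ 1 Vz (Vx m)).
  have /= := zP _ (VD _ _ (-1) Vz (Vx m)).
  rewrite !(addrC z) !addrK scale1r scaleN1r !dotDl dotBr !linearNl linearNr.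
  rewrite (dotC (x m) z); lra.
have yort : dot y (u - z) = 0.
  apply: (cvg_unique _ (xy (u - z))) => //.
  by apply: cvg_near_cst; apply: nearW => n; exact: xort.
have Vuz : V (u - z).
  by apply: cvg_near_cst; apply: nearW => n; rewrite yort; exact: xort.
by have := VD _ _ 1 Vz Vuz; rewrite scale1r addrC subrK.
Unshelve. all: by end_near. Qed.

(* If two cluster points y, y' lie in Z, then [<x_n, y - y'>] converges, by
   polarisation of [|x_n - y|^2 - |x_n - y'|^2], so that [|y - y'|^2 = 0]. *)
Lemma opial (Z : set H) (x : nat -> H) (M : R) : (forall n, `|x n| <= M) ->
  (forall z, Z z -> cvgn (fun n => `|x n - z| ^+ 2)) ->
  (forall y, weak_seq_cluster_point dot x y -> Z y) ->
  exists2 z, Z z & weakly_cvg dot x z.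
Proof.
move=> xM xZ clZ.
have ultraZ U : UltraFilter U -> \oo `<=` U ->
    exists2 y, Z y & forall u, dot (x n) u @[n --> U] --> dot y u.
  move=> UU ooU; have [y xy] := bounded_weak_cvg_ultra UU xM.
  by exists y => //; apply: clZ; exact: ultra_weak_limit_seq_cluster ooU xM xy.
have [U0 [UU0 ooU0]] := @ultraFilterLemma _ \oo _.
have [y0 Zy0 xy0] := ultraZ U0 UU0 ooU0; exists y0 => // u.
apply/cvgrPdist_lt => e e0; apply: contrapT => nclose.
(* If convergence against [u] fails, [A] contains arbitrarily large indices, so some ultrafilter
   finer than [\oo] contains [A]. Its weak limit must again be [y0], a contradiction. *)
pose A := [set n | ~ `|dot y0 u - dot (x n) u| < e].
have PA : ProperFilter (within A \oo).
  split; last exact: within_filter.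
  rewrite /within /= => A0; apply: nclose.
  by apply: filterS A0 => n nA; apply: contrapT => /nA.
have [U [UU AU]] := ultraFilterLemma PA.
have ooU : \oo `<=` U by move=> B ooB; apply: AU; exact: cvg_within ooB.
have [y Zy xy] := ultraZ U UU ooU.
have yy0 : y = y0.
  have [l xl] : exists l : R, dot (x n) (y - y0) @[n --> \oo] --> l.
    exists (2^-1 * (limn (fun n => `|x n - y0| ^+ 2) -
      limn (fun n => `|x n - y| ^+ 2) + (`|y| ^+ 2 - `|y0| ^+ 2))).
    rewrite (_ : (fun n => _) = (fun n => 2^-1 *
      (`|x n - y0| ^+ 2 - `|x n - y| ^+ 2 + (`|y| ^+ 2 - `|y0| ^+ 2)))).
      apply: cvgM; first exact: cvg_cst.
      apply: cvgD; last exact: cvg_cst.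
      by apply: cvgB; exact: xZ.
    by apply/funext => n; rewrite !sqr_normB dotBr; field.
  have ly : dot y (y - y0) = l.
    by apply: (cvg_unique _ (xy _)) => //; apply: cvg_trans xl => B /ooU.
  have ly0 : dot y0 (y - y0) = l.
    by apply: (cvg_unique _ (xy0 _)) => //; apply: cvg_trans xl => B /ooU0.
  apply/eqP; rewrite -subr_eq0 -normr_eq0 -sqrf_eq0 -dotE dotBl ly ly0.
  by rewrite subrr.
have UA : U A by apply: AU; exact: withinT.
have Uclose : U [set n | `|dot y0 u - dot (x n) u| < e].
  by rewrite -yy0; exact: (@cvgr_dist_lt _ _ _ U _ _ _ (xy u)).
by have [n [nA /nA]] := filter_ex (filterI UA Uclose).
Qed.

Lemma half_space_closed_segment D : closed_half_space dot D -> closed D /\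
  (forall z w t, D z -> D w -> 0 <= t <= 1 -> D (z + t *: (w - z))).
Proof.
move=> [u [eta [_ ->]]]; split.
  apply: (@preimage_closed _ _ (dot ^~ u) [set r | r <= eta]) => [z _|].
    exact: dot_continuousl.
  exact: closed_le.
by move=> z w t /= zu wu /andP[t0 t1]; rewrite dotDl dotZl dotBl; nra.
Qed.

End RealHilbert.

Theorem theorem4p2 (R : realType) (H : completeNormedModType R)
    (dot : {dot H for idfun}) (dotE : induces_norm dot)
    (Z : set H) (Z_neq0 : Z !=set0) (Z_closed : closed Z)
    (Z_convex : convex_set Z)
    (lambda : nat -> R) (lambda02 : forall n, 0 < lambda n < 2)
    (x0 : H) (x p : nat -> H) (Hs : nat -> set H)
    (Hs_half : forall n, closed_half_space dot (Hs n))
    (Z_sub : forall n, Z `<=` Hs n)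
    (x_init : x 0%N = x0)
    (p_def : forall n, p n = convex_proj (Hs n) (x n))
    (x_step : forall n, x n.+1 = x n + lambda n *: (p n - x n)) :
  [/\ forall z, Z z -> forall n, `|x n.+1 - z| <= `|x n - z|,
      (\sum_(0 <= n <oo)
        (lambda n * (2 - lambda n) * `|p n - x n| ^+ 2)%:E < +oo)%E,
      sup (range lambda) < 2 ->
        (\sum_(0 <= n <oo) (`|x n.+1 - x n| ^+ 2)%:E < +oo)%E
    & (forall y, weak_seq_cluster_point dot x y -> Z y) ->
        exists2 z, Z z & weakly_cvg dot x z].
Proof.
pose r n := lambda n * (2 - lambda n) * `|p n - x n| ^+ 2.
have l0 n : 0 < lambda n by have /andP[] := lambda02 n.
have l2 n : lambda n < 2 by have /andP[] := lambda02 n.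
have r0 n : 0 <= r n by rewrite /r !mulr_ge0 ?sqr_ge0// ?subr_ge0 ltW.
have step z n : Z z -> `|x n.+1 - z| ^+ 2 <= `|x n - z| ^+ 2 - r n.
  move=> Zz; rewrite x_step; apply: relaxed_projection_fejer => //.
    exact: ltW.
  have [Dcl Dconv] := half_space_closed_segment dotE (Hs_half n).
  rewrite p_def; apply: convex_projP => //; last exact: Z_sub.
  by exists z; exact: Z_sub.
have fejer z n : Z z -> `|x n.+1 - z| <= `|x n - z|.
  move=> Zz; rewrite -(@ler_pXn2r _ 2)// ?nnegrE//.
  by apply: le_trans (step _ _ Zz) _; rewrite gerBl.
have [z0 Zz0] := Z_neq0.
have r_sum n : \sum_(0 <= i < n) r i <= `|x 0%N - z0| ^+ 2.
  (* Keeping the term in [x n] makes the induction telescope. *)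
  suff : \sum_(0 <= i < n) r i <= `|x 0%N - z0| ^+ 2 - `|x n - z0| ^+ 2.
    by move=> /le_trans; apply; rewrite gerBl sqr_ge0.
  elim: n => [|n IHn]; first by rewrite big_geq// subrr.
  by rewrite big_nat_recr//=; have := step _ n Zz0; lra.
split.
- by move=> z Zz n; exact: fejer.
- exact: nneseries_partial_bounded_lty r0 r_sum.
- set s := sup _ => s2.
  have s_ub n : lambda n <= s.
    apply: ub_le_sup; last by exists n.
    by exists 2 => _ [m _ <-]; exact: ltW.
  have c0 : 0 < 2 / (2 - s) by rewrite divr_gt0// subr_gt0.
  apply: (@nneseries_partial_bounded_lty _ _
    (2 / (2 - s) * `|x 0%N - z0| ^+ 2)).
    by move=> n; exact: sqr_ge0.
  move=> n; apply: le_trans (_ : 2 / (2 - s) * \sum_(0 <= i < n) r i <= _).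
    rewrite big_distrr/=; apply: ler_sum => i _.
    rewrite x_step (addrC (x i)) addrK normrZ exprMn real_normK ?num_real//.
    rewrite /r [leRHS]mulrA ler_wpM2r ?sqr_ge0//.
    rewrite [leRHS]mulrAC ler_pdivlMr ?subr_gt0//.
    (* The claim is [lambda^2 (2 - s) <= 2 lambda (2 - lambda)]; the difference of its sides is
       [lambda^2 (s - lambda) + lambda (2 - lambda)^2]. *)
    have s_lambda : 0 <= s - lambda i by rewrite subr_ge0.
    have := mulr_ge0 (sqr_ge0 (lambda i)) s_lambda.
    have := mulr_ge0 (ltW (l0 i)) (sqr_ge0 (2 - lambda i)).
    lra.
  by rewrite ler_pM2l.
- move=> clZ; have xz_le z n : Z z -> `|x n - z| <= `|x 0%N - z|.
    by move=> Zz; elim: n => // n; apply: le_trans; exact: fejer.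
  (* Monotonicity of the distances to points of [Z] gives both the norm bound, through [z0], and the
     convergence of [|x n - z|^2]. *)
  apply: (@opial _ _ _ dotE Z x (`|x 0%N - z0| + `|z0|)) => //.
    move=> n; rewrite -[x n](subrK z0); apply: le_trans (ler_normD _ _) _.
    by rewrite lerD2r xz_le.
  move=> z Zz; apply: nonincreasing_is_cvgn.
    apply/nonincreasing_seqP => n.
    by rewrite ler_pXn2r// ?nnegrE//; exact: fejer.
  by exists 0 => _ [n _ <-]; exact: sqr_ge0.
Qed.
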